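(* Let $f:[0,1]\to\mathbb{R}$ be given by a power series $f(x)=f_0+f_1x+f_2x^2+\cdots$ and let $k\in\mathbb{N}$ have exactly $v$ non-zero base $b$ digits. Then $$|\hat f(k)|\le \min_{0\le u\le v}\; b^{-\mu_u(k)}\,\frac{3^{\min(1,u)}}{(2\sin\frac{\pi}{b})^u}\left(1+\frac1b+\frac1{b(b+1)}\right)^{\max(0,u-1)}\sum_{r=v}^\infty\frac{r!\,|f_r|}{(r-u+1)!},$$ where the minimum is over integers $u$ and is taken of the whole expression (the sum depends on $u$ and may equal $+\infty$ for some $u$).
   Context: Let $b\ge 2$ be an integer and $\omega_b=e^{2\pi \mathrm{i}/b}$; $\mathbb{N}=\{1,2,\ldots\}$. Each $k\in\mathbb{N}$ has the base $b$ expansion $k=\kappa_1b^{a_1-1}+\cdots+\kappa_vb^{a_v-1}$ with $v\ge1$, $0<\kappa_1,\ldots,\kappa_v<b$ and $a_1>\cdots>a_v>0$ integers; for $k=0$ set $v=0$. For $x\in[0,1)$ with base $b$ representation $x=\frac{x_1}{b}+\frac{x_2}{b^2}+\cdots$, $0\le x_i<b$, infinitely many $x_i\neq b-1$, the $k$th Walsh function is $\mathrm{wal}_k(x)=\omega_b^{\kappa_1x_{a_1}+\cdots+\kappa_vx_{a_v}}$, and $\mathrm{wal}_0(x)=1$. The $k$th Walsh coefficient of $f:[0,1]\to\mathbb{R}$ is $\hat f(k)=\int_0^1f(x)\overline{\mathrm{wal}_k(x)}\,dx$. For integers $r\ge0$, $k\ge 0$ define $\mu_r(k)=0$ if $r=0$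 or $k=0$; $\mu_r(k)=a_1+\cdots+a_v$ if $1\le v\le r$; and $\mu_r(k)=a_1+\cdots+a_r$ if $v>r\ge1$. *)

(* Defs.v *)
From HB Require Import structures.
From mathcomp Require Import all_boot all_order all_algebra.
From mathcomp Require Import all_classical all_reals all_analysis.
From mathcomp Require Import complex.
From mathcomp Require Import ring lra zify.

Set Implicit Arguments.
Unset Strict Implicit.
Unset Printing Implicit Defensive.
Import Order.TTheory GRing.Theory Num.Theory.
Import numFieldNormedType.Exports.
Local Open Scope classical_set_scope.
Local Open Scope ring_scope.

Section NatDigits.
Local Open Scope nat_scope.

Definition kdigit (b k j : nat) : nat := (k %/ b ^ j) %% b.

(* The exponents a_1 > ... > a_v in k = kappa_1 b^(a_1 - 1) + ... +
   kappa_v b^(a_v - 1), where kappa_i = kdigit b k (a_i - 1) != 0; they are at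
   most k because k < b^k. *)
Definition nzpos (b k : nat) : seq nat :=
  [seq a <- rev (iota 1 k) | kdigit b k a.-1 != 0].

(* [take] covers every case of the definition of mu_r(k): it is empty for r = 0
   or k = 0, and the whole list when there are at most r non-zero digits. *)
Definition mu (b r k : nat) : nat := \sum_(a <- take r (nzpos b k)) a.

Lemma sum_kdigit (b k n : nat) : 0 < b ->
  \sum_(j < n) kdigit b k j * b ^ j = k %% b ^ n.
Proof.
move=> b0; elim: n => [|n IHn]; first by rewrite big_ord0 expn0 modn1.
rewrite big_ord_recr /= IHn /kdigit.
have bn : 0 < b ^ n by rewrite expn_gt0 b0.
have h1 := ltn_pmod (k %/ b ^ n) b0.
have h2 := ltn_pmod k bn.
rewrite [in RHS](divn_eq k (b ^ n)) [in RHS](divn_eq (k %/ b ^ n) b).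
rewrite mulnDl -mulnA -expnS -addnA modnMDl [RHS]modn_small 1?addnC//.
by rewrite expnS; nia.
Qed.

Lemma nzposP (b k : nat) : 2 <= b ->
  [/\ sorted gtn (nzpos b k),
      forall a, a \in nzpos b k -> 0 < a /\ 0 < kdigit b k a.-1 < b
    & k = \sum_(a <- nzpos b k) kdigit b k a.-1 * b ^ a.-1].
Proof.
move=> b2; split.
- apply: sorted_filter; first by move=> x y z /= h1 h2; apply: ltn_trans h2 h1.
  by rewrite rev_sorted; apply: iota_ltn_sorted.
- move=> a; rewrite mem_filter mem_rev mem_iota => /andP[ka /andP[a0 _]].
  by split=> //; rewrite lt0n ka ltn_pmod// (ltn_trans _ b2).
- have kb : k < b ^ k by apply: ltn_expl.
  rewrite -{1}(modn_small kb) -sum_kdigit ?(ltn_trans _ b2)// /nzpos big_filter.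
  rewrite (perm_big (iota 1 k)) /=; last by rewrite perm_rev.
  rewrite -(big_mkord xpredT (fun j => kdigit b k j * b ^ j)).
  rewrite -[iota 1 k]/(iota 1 (0 + k)) -[in iota _ _]addn1.
  have -> : iota 1 (0 + k) = index_iota 1 k.+1 by rewrite /index_iota subSS subn0.
  rewrite big_add1 /= [RHS]big_mkcond /=; apply: eq_bigr => i _.
  by case: eqP => // ->; rewrite mul0n.
Qed.

End NatDigits.

Section RealDigits.
Context {R : realType}.
Implicit Types (b i n : nat) (x y : R) (d : nat -> nat).

(* The i-th digit (i >= 1) in closed form; [base_expansion_xdigit] and
   [base_expansion_uniq] identify it with the digit of the expansion of x that
   has infinitely many digits different from b - 1. *)
Definition xdigit b x i : nat := (Num.truncn (b%:R ^+ i * x) %% b)%N.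

(* Only d 1, d 2, ... are digits; d 0 is irrelevant. *)
Definition base_expansion b x d : Prop :=
  [/\ forall i, (0 < i)%N -> (d i < b)%N,
      series (fun i => (d i.+1)%:R / b%:R ^+ i.+1 : R) @ \oo --> x
    & forall n, exists2 i, (n < i)%N & d i != b.-1].

Let T b d n : nat := (\sum_(i < n) d i.+1 * b ^ (n - i.+1))%N.

Let TS b d n : T b d n.+1 = (b * T b d n + d n.+1)%N.
Proof.
rewrite /T big_ord_recr /= subnn expn0 muln1 big_distrr /=; congr addn.
by apply: eq_bigr => i _; rewrite mulnCA -expnS subSn.
Qed.

Let seriesT b d n : (0 < b)%N ->
  series (fun i => (d i.+1)%:R / b%:R ^+ i.+1 : R) n = (T b d n)%:R / b%:R ^+ n.
Proof.
move=> b0; have bn0 : b%:R != 0 :> R by rewrite pnatr_eq0 -lt0n.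
elim: n => [|n IHn]; first by rewrite seriesEnat /= big_geq// /T big_ord0 mul0r.
rewrite seriesSr IHn TS natrD natrM exprS.
by field; rewrite bn0 expf_neq0.
Qed.

Let truncnM b y : (0 < b)%N -> 0 <= y ->
  (Num.truncn (b%:R * y) %/ b)%N = Num.truncn y.
Proof.
move=> b0 y0; have b0' : 0 < b%:R :> R by rewrite ltr0n.
apply/esym/truncn_def; have /andP[h1 h2] := truncn_itv (mulr_ge0 (ltW b0') y0).
set t := Num.truncn _ in h1 h2 *.
rewrite -(ler_pM2l b0') -(ltr_pM2l b0') -!natrM; apply/andP; split.
  by apply: le_trans h1; rewrite ler_nat mulnC leq_divM.
by apply: lt_le_trans h2 _; rewrite ler_nat mulnC ltn_ceil.
Qed.

Let T_xdigit b x n : (0 < b)%N -> 0 <= x < 1 ->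
  T b (xdigit b x) n = Num.truncn (b%:R ^+ n * x).
Proof.
move=> b0 /andP[x0 x1]; elim: n => [|n IHn].
  by rewrite /T big_ord0 expr0 mul1r; apply/esym/truncn_def; rewrite x0.
rewrite TS IHn /xdigit [in RHS](divn_eq (Num.truncn _) b) exprS -mulrA.
by rewrite truncnM ?mulr_ge0 ?exprn_ge0 ?ler0n// mulnC.
Qed.

Let cvg_invX b : (2 <= b)%N -> (fun n => (b%:R ^+ n)^-1 : R) @ \oo --> (0 : R).
Proof.
move=> b2; under eq_fun do rewrite -exprVn; apply: cvg_expr.
by rewrite ger0_norm ?invr_ge0 ?ler0n// invf_lt1 ?ltr0n ?ltr1n// (ltn_trans _ b2).
Qed.

Lemma base_expansion_xdigit b x : (2 <= b)%N -> 0 <= x < 1 ->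
  base_expansion b x (xdigit b x).
Proof.
move=> b2 x01; have b0 : (0 < b)%N by apply: ltn_trans b2.
have bX n : 0 < b%:R ^+ n :> R by rewrite exprn_gt0 ?ltr0n.
have tP n := truncn_itv (mulr_ge0 (ltW (bX n)) (andP x01).1).
split.
- by move=> i _; rewrite ltn_pmod.
- apply: (@squeeze_cvgr _ _ _ _ (fun n => x - (b%:R ^+ n)^-1) (fun=> x)).
  + apply: nearW => n; rewrite seriesT// T_xdigit//.
    have /andP[h1 h2] := tP n.
    rewrite ler_pdivlMr ?ler_pdivrMr// mulrBl mulVf ?gt_eqF//.
    by rewrite [x * _]mulrC h1 andbT lerBlDr natr1 ltW.
  + rewrite -[X in _ --> X]subr0; apply: cvgB; [exact: cvg_cst|exact: cvg_invX].
  + exact: cvg_cst.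
- move=> n; apply: contrapT => h.
  have dE m : (n <= m)%N -> xdigit b x m.+1 = b.-1.
    by move=> nm; apply: contrapT => /eqP hm; apply: h; exists m.+1.
  have tE m : (T b (xdigit b x) (n + m)).+1
      = (b ^ m * (T b (xdigit b x) n).+1)%N.
    elim: m => [|m IHm]; first by rewrite addn0 expn0 mul1n.
    rewrite addnS TS dE ?leq_addr// expnS -mulnA -IHm; nia.
  set e := (T b (xdigit b x) n).+1%:R - b%:R ^+ n * x.
  have e0 : 0 < e.
    by rewrite subr_gt0 T_xdigit//; case/andP: (tP n).
  have le1 m : b%:R ^+ m * e <= 1.
    have /andP[h1 _] := tP (n + m)%N.
    rewrite -T_xdigit// in h1.
    rewrite mulrBr -natrX -natrM -tE natrX mulrA -exprD [(m + n)%N]addnC.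
    by rewrite -natr1; lra.
  have := le1 (Num.bound e^-1); apply/negP; rewrite -ltNge.
  rewrite -ltr_pdivrMr// mul1r.
  apply: lt_trans (archi_boundP _) _; first by rewrite invr_ge0 ltW.
  by rewrite -natrX ltr_nat ltn_expl.
Qed.

Lemma base_expansion_uniq b x d : (2 <= b)%N ->
  base_expansion b x d -> forall i, (0 < i)%N -> d i = xdigit b x i.
Proof.
move=> b2 [db dx dinf]; have b0 : (0 < b)%N by apply: ltn_trans b2.
have bX n : 0 < b%:R ^+ n :> R by rewrite exprn_gt0 ?ltr0n.
have b0' : b%:R != 0 :> R by rewrite pnatr_eq0 -lt0n.
pose U n : R := (T b d n).+1%:R / b%:R ^+ n.
have UE n : U n = series (fun i => (d i.+1)%:R / b%:R ^+ i.+1 : R) n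
                  + (b%:R ^+ n)^-1.
  by rewrite seriesT// /U -natr1 mulrDl mul1r.
have US n : U n.+1 <= U n ?= iff (d n.+1 == b.-1).
  have -> : U n = (b * (T b d n).+1)%:R / b%:R ^+ n.+1.
    by rewrite /U natrM exprS; field; rewrite b0' expf_neq0.
  have dn := db n.+1 isT.
  split; first by rewrite ler_pM2r ?invr_gt0// ler_nat TS; nia.
  have bi : (b%:R ^+ n.+1)^-1 != 0 :> R by rewrite invr_eq0 gt_eqF.
  rewrite /U (inj_eq (mulIf bi)) eqr_nat TS.
  by apply/eqP/eqP; nia.
have Uni : nonincreasing_seq U.
  by apply/nonincreasing_seqP => n; exact: US.
have Ux : U @ \oo --> x.
  rewrite (_ : U = series (fun i => (d i.+1)%:R / b%:R ^+ i.+1 : R)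
                   \+ (fun n => (b%:R ^+ n)^-1)); last exact/funext.
  by rewrite -[X in _ --> X]addr0; apply: cvgD => //; exact: cvg_invX.
have xU n : x <= U n.
  rewrite -(cvg_lim _ Ux)//; apply: nonincreasing_cvgn_ge => //.
  by apply/cvg_ex; exists x.
have Sx n : (T b d n)%:R / b%:R ^+ n <= x.
  rewrite -seriesT// -(cvg_lim _ dx)//; apply: nondecreasing_cvgn_le.
    by apply: nondecreasing_series => i _ _; rewrite divr_ge0 ?ler0n ?ltW.
  by apply/cvg_ex; exists x.
have TE n : Num.truncn (b%:R ^+ n * x) = T b d n.
  apply: truncn_def; apply/andP; split.
    by rewrite mulrC -ler_pdivrMr.
  rewrite mulrC -ltr_pdivlMr//.
  have [[//|m] nm dm] := dinf n.
  have Unm : U m <= U n by exact: Uni.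
  rewrite -/(U n); apply: le_lt_trans (xU m.+1) _; apply: lt_le_trans Unm.
  by rewrite (lt_leif (US m)).
case=> // i _; rewrite /xdigit TE TS mulnC modnMDl modn_small//; exact: db.
Qed.

End RealDigits.

Section Walsh.
Context {R : realType}.

(* omega_b = e^(2 pi i / b) *)
Definition omega (b : nat) : R[i] :=
  (cos (2 * pi / b%:R) +i* sin (2 * pi / b%:R))%C.

Definition wal (b k : nat) (x : R) : R[i] :=
  omega b ^+ (\sum_(a <- nzpos b k) kdigit b k a.-1 * xdigit b x a)%N.

(* Walsh functions live on [0, 1[; the value of [wal] at 1 does not affect the
   integral. *)
Definition walsh_coef (b : nat) (f : R -> R) (k : nat) : R[i] :=
  let g x := ((f x)%:C * (wal b k x)^*)%C in
  (\int[lebesgue_measure]_(x in `[0, 1]) complex.Re (g x)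
   +i* \int[lebesgue_measure]_(x in `[0, 1]) complex.Im (g x))%C.

End Walsh.

(* Main.v *)
(* Integrating by parts once per non-zero digit of k, starting with the finest
   one, gives fhat(k) = +- int f^(u) W_u w_(u+1) ... w_v, where W_u is the u-fold
   primitive of the top u Walsh factors and the remaining w_j are unimodular.
   The kernel W_u has mean m_u with |m_u| <= b^(-mu_u(k)) / (2 sin(pi/b))^u, and
   |W_u - m_u| <= osc_u b^(-mu_u(k)) / (2 sin(pi/b))^u with osc_(u+1) =
   1 + sin(pi/b) osc_u: the factor sin(pi/b) comes from 1 / (2 s) with
   s = 1 / (2 sin(pi/b)), the 1/2 being gained because the primitive of W_u - m_u
   vanishes at both ends of each period.  Then 1 + osc_u is at most the constant
   of the theorem.
   The kernels never appear explicitly: they are replaced by the functionals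
   F |-> int F' w_1 ... w_j over one block, which on polynomials are finite sums
   of values of F, and bounds on kernels become bounds of these functionals by
   increments of a primitive H of a majorant of the derivative of F.  The power
   series is then integrated term by term by dominated convergence, the sum over
   r of |f_r| / (r+1) being finite whenever the right-hand side is.  Monomials of
   degree r < v are orthogonal to wal_k. *)
Require Import Defs.
From mathcomp Require Import all_boot all_order all_algebra.
From mathcomp Require Import all_classical all_reals all_analysis.
From mathcomp Require Import measurable_realfun complex.
From mathcomp Require Import polyrcf ring lra zify.
Import Order.TTheory GRing.Theory Num.Theory.
Import numFieldNormedType.Exports.
Set Implicit Arguments.
Unset Strict Implicit.
Unset Printing Implicit Defensive.
Local Open Scope classical_set_scope.
Local Open Scope ring_scope.

Local Notation "x %:C" := (real_complex _ x) : ring_scope.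

(** * Polynomial increments *)

Lemma horner_le_deriv_ge0 (R : rcfType) (p : {poly R}) (l r : R) : l <= r ->
  (forall x, l <= x <= r -> 0 <= p^`().[x]) -> p.[l] <= p.[r].
Proof.
move=> lr p0; apply: (@ler_hornerW _ l r) => //; last 2 first.
- by rewrite in_itv /= lexx lr.
- by rewrite in_itv /= lexx lr.
by move=> x; rewrite in_itv /= => /andP[lx xr]; apply: p0; rewrite !ltW.
Qed.

Lemma horner_incr_le (R : rcfType) (G H : {poly R}) (l r : R) : l <= r ->
  (forall x, l <= x <= r -> `|G^`().[x]| <= H^`().[x]) ->
  `|G.[r] - G.[l]| <= H.[r] - H.[l].
Proof.
move=> lr GH.
have h1 : (H - G).[l] <= (H - G).[r].
  apply: horner_le_deriv_ge0 => // x /GH.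
  by rewrite derivB hornerD hornerN ler_norml => /andP[]; lra.
have h2 : (H + G).[l] <= (H + G).[r].
  apply: horner_le_deriv_ge0 => // x /GH.
  by rewrite derivD hornerD ler_norml => /andP[]; lra.
by move: h1 h2; rewrite !hornerE ler_norml => h1 h2; apply/andP; split; lra.
Qed.

(** [P] is the right side minus the left side with [r] replaced by a variable x, so it vanishes at
    [l]. Its derivative is (x - l)(H' - G'') + (H(x) - H(l)) + (G'(x) - G'(l)); the first term and
    the sum of the other two are non-negative because H' majorizes |G''|. *)
Lemma trapezoid_le (R : rcfType) (G H : {poly R}) (l r : R) : l <= r ->
  (forall x, l <= x <= r -> `|G^`(2).[x]| <= H^`().[x]) ->
  (r - l) * (G^`().[r] + G^`().[l]) - 2 * (G.[r] - G.[l])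
    <= (r - l) * (H.[r] - H.[l]).
Proof.
move=> lr GH.
pose P := ('X - l%:P) * (H - H.[l]%:P)
  - (('X - l%:P) * (G^`() + G^`().[l]%:P) - 2 *: (G - G.[l]%:P)).
have : P.[l] <= P.[r].
  apply: horner_le_deriv_ge0 => // x /andP[lx xr].
  have : `|G^`().[x] - G^`().[l]| <= H.[x] - H.[l].
    by apply: horner_incr_le => // y /andP[ly yx]; apply: GH; rewrite ly (le_trans yx).
  have := GH x; rewrite lx xr => /(_ isT).
  rewrite !ler_norml => /andP[_ GHx] /andP[xH _].
  have : 0 <= (x - l) * (H^`().[x] - G^`(2).[x]) by rewrite mulr_ge0//; lra.
  rewrite /P !poly.derivE !hornerE /=.
  rewrite /derivn /=; lra.
by rewrite /P !hornerE /=; lra.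
Qed.

(* Both one-sided first-order errors are controlled together; bounding each of
   them separately would lose a factor 2. *)
Lemma taylor_sum_le (R : rcfType) (G H : {poly R}) (l r : R) : l <= r ->
  (forall x, l <= x <= r -> `|G^`(2).[x]| <= H^`().[x]) ->
  `|G.[r] - G.[l] - (r - l) * G^`().[r]| + `|G.[r] - G.[l] - (r - l) * G^`().[l]|
    <= (r - l) * (H.[r] - H.[l]).
Proof.
move=> lr GH.
have t1 := @trapezoid_le _ _ _ _ _ lr GH.
have : (r - l) * ((- G)^`().[r] + (- G)^`().[l]) - 2 * ((- G).[r] - (- G).[l])
    <= (r - l) * (H.[r] - H.[l]).
  by apply: trapezoid_le => // x /GH; rewrite derivnN hornerN normrN.
rewrite derivN !hornerN => t2.
have : `|G^`().[r] - G^`().[l]| <= H.[r] - H.[l] by apply: horner_incr_le.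
rewrite ler_norml => /andP[d1 d2].
have rl : 0 <= r - l by lra.
have := ler_wpM2l rl d1; have := ler_wpM2l rl d2.
(* If the two errors have the same sign, their absolute values add up to a trapezoid defect, bounded
   by [t1] or [t2]; if the signs are opposite, the sum is (r - l) |G'(r) - G'(l)|, bounded by [d1]
   and [d2]. *)
by case: (ltrgt0P (G.[r] - G.[l] - (r - l) * G^`().[r])) => ?;
   case: (ltrgt0P (G.[r] - G.[l] - (r - l) * G^`().[l])) => ?; lra.
Qed.

(** * Abel summation against roots of unity *)

Lemma normC_real (R : rcfType) (x : R) : `|x%:C| = `|x|%:C.
Proof. by rewrite normc_def /= expr0n addr0 sqrtr_sqr. Qed.

(** Each new term adds z^n (z - 1)^-1 (z a - c) to the error, where a and c are the first-order
    Taylor errors of [G] over the new interval based at its right and left ends. As |z| = 1, only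
    |a| + |c| matters, which is the quantity in [taylor_sum_le]. *)
Lemma abel_sum_le (R : rcfType) (G H : {poly R}) (z : R[i]) (s h y : R) n :
  0 <= h -> `|z| = 1 -> z != 1 -> `|(z - 1)^-1| <= s%:C ->
  (forall x, y <= x <= y + n%:R * h -> `|G^`(2).[x]| <= H^`().[x]) ->
  `|\sum_(i < n) z ^+ i * (G.[y + i.+1%:R * h] - G.[y + i%:R * h])%:C
    - h%:C / (z - 1) * (z ^+ n * (G^`().[y + n%:R * h])%:C - (G^`().[y])%:C)|
  <= (s * h * (H.[y + n%:R * h] - H.[y]))%:C.
Proof.
move=> h0 z1 zn1 zs; elim: n => [_|n IHn GH].
  by rewrite big_ord0 mul0r addr0 expr0 mul1r !subrr mulr0 subrr normr0 mulr0.
have nh : y + n.+1%:R * h = (y + n%:R * h) + h by rewrite -natr1; ring.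
have yn : y <= y + n%:R * h by rewrite lerDl mulr_ge0.
rewrite big_ord_recr /=.
set S := \sum_(i < n) _ in IHn *.
set l := y + n%:R * h in nh yn IHn *; set r := y + n.+1%:R * h in nh GH *.
have lr : l <= r by lra.
have GHl x : y <= x <= l -> `|G^`(2).[x]| <= H^`().[x].
  by move=> /andP[yx xl]; apply: GH; lra.
have GHr x : l <= x <= r -> `|G^`(2).[x]| <= H^`().[x].
  by move=> /andP[lx xr]; apply: GH; lra.
have := taylor_sum_le lr GHr; have -> : r - l = h by lra.
set a := G.[r] - G.[l] - h * G^`().[r]; set c := G.[r] - G.[l] - h * G^`().[l].
move=> ac.
have zN0 : z - 1 != 0 by rewrite subr_eq0.
rewrite (_ : _ - _ = (S - h%:C / (z - 1) * (z ^+ n * (G^`().[l])%:C - (G^`().[y])%:C))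
   + z ^+ n * (z - 1)^-1 * (z * a%:C - c%:C)); last first.
  by rewrite /a /c !(rmorphB, rmorphM) /= exprS; field.
apply: le_trans (ler_normD _ _) _.
rewrite (_ : (s * h * _)%:C = (s * h * (H.[l] - H.[y]))%:C + s%:C * (h * (H.[r] - H.[l]))%:C).
  apply: lerD; first exact: IHn.
  rewrite !normrM normrX z1 expr1n mul1r; apply: ler_pM => //.
  apply: le_trans (ler_normB _ _) _.
  by rewrite normrM z1 mul1r !normC_real -rmorphD lecR.
by rewrite !(rmorphB, rmorphM) /=; ring.
Qed.

Lemma root_unity_sum0 (F : fieldType) (z : F) b : z ^+ b = 1 -> z != 1 ->
  \sum_(i < b) z ^+ i = 0.
Proof.
move=> zb z1; have := subrX1 z b; rewrite zb subrr => /esym/eqP.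
by rewrite mulf_eq0 subr_eq0 (negbTE z1) => /eqP.
Qed.

Lemma root_unity_sum_index (F : fieldType) (z : F) b : z ^+ b = 1 -> z != 1 ->
  \sum_(i < b) i%:R * z ^+ i = b%:R / (z - 1).
Proof.
move=> zb z1; have zN0 : z - 1 != 0 by rewrite subr_eq0.
have E n : (z - 1) * (\sum_(i < n) i%:R * z ^+ i) + \sum_(i < n) z ^+ i.+1
           = n%:R * z ^+ n.
  elim: n => [|n IHn]; first by rewrite !big_ord0 mulr0 addr0 mul0r.
  rewrite !big_ord_recr /= mulrDr addrACA IHn -natr1 exprS; ring.
have := E b; rewrite zb mulr1 => <-.
under [\sum_(i < b) z ^+ i.+1]eq_bigr do rewrite exprS.
by rewrite -mulr_sumr root_unity_sum0// mulr0 addr0; field.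
Qed.

Lemma derivn3_quadratic (R : rcfType) (G : {poly R}) : G^`(3) = 0 ->
  exists g0 g1 g2, G = g0%:P + g1 *: 'X + g2 *: 'X ^+ 2.
Proof.
move=> G3; exists G`_0, G`_1, G`_2.
apply/polyP => -[|[|[|i]]]; rewrite ?coefE /= ?mulr0 ?mulr1 ?addr0 ?add0r//.
have := congr1 (fun p : {poly R} => p`_i) G3.
rewrite coef_derivn coef0 addSn addSn addSn add0n => /eqP.
by rewrite mulrn_eq0 gt_eqF ?ffact_gt0//= => /eqP.
Qed.

(** The increments of a quadratic are affine in i, so the two root of unity sums above evaluate the
    left side and the Abel summation is exact over a full period. *)
Lemma abel_sum_quadratic (R : rcfType) (G : {poly R}) (z : R[i]) (h y : R) b :
  z ^+ b = 1 -> z != 1 -> G^`(3) = 0 ->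
  \sum_(i < b) z ^+ i * (G.[y + i.+1%:R * h] - G.[y + i%:R * h])%:C
  = h%:C / (z - 1) * (G^`().[y + b%:R * h] - G^`().[y])%:C.
Proof.
move=> zb z1 /derivn3_quadratic[g0 [g1 [g2 ->]]].
have zN0 : z - 1 != 0 by rewrite subr_eq0.
under eq_bigr => i _.
  rewrite (_ : _ * _ = (g1 * h + g2 * h * (2 * y + h))%:C * z ^+ i
     + (2 * g2 * h ^+ 2)%:C * (i%:R * z ^+ i)); last first.
    rewrite !hornerE /= -natr1 -[i%:R in RHS](rmorph_nat (real_complex R)).
    rewrite !(rmorphB, rmorphM, rmorphD, rmorphXn, rmorph1, rmorph_nat) /=; ring.
  over.
rewrite big_split /= -!mulr_sumr root_unity_sum0// root_unity_sum_index//.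
rewrite !poly.derivE !hornerE /= -[b%:R in LHS](rmorph_nat (real_complex R)).
rewrite !(rmorphB, rmorphM, rmorphD, rmorphXn, rmorph1, rmorph_nat) /=; field.
exact: zN0.
Qed.

(** * Twisted increments over nested blocks *)

(* For F a primitive of g, this is the integral of
   g(y + x) prod_(i < t) z_i^(d_i(x)) over x in [0, e b^t], where d_i(x) is the
   i-th base b digit of floor(x / e). *)
Fixpoint twist (R : rcfType) (b : nat) (e : R) (z : nat -> R[i]) (t : nat)
    (F : {poly R}) (y : R) : R[i] :=
  if t is t'.+1 then
    \sum_(i < b) z t' ^+ i * twist b e z t' F (y + i%:R * (e * b%:R ^+ t'))
  else (F.[y + e] - F.[y])%:C.

Section Twist.
Variables (R : rcfType) (b : nat) (e : R) (z : nat -> R[i]).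
Hypothesis e_ge0 : 0 <= e.
Local Notation A := (twist b e z).

Lemma twistP t a F G y : A t (a *: F + G) y = a%:C * A t F y + A t G y.
Proof.
elim: t y => [|t IHt] y /=.
  by rewrite -rmorphM -rmorphD !hornerD !hornerZ; congr (_%:C); ring.
rewrite mulr_sumr -big_split; apply: eq_bigr => i _.
by rewrite IHt /=; ring.
Qed.

Lemma twistB t F G y : A t (F - G) y = A t F y - A t G y.
Proof. by rewrite addrC -scaleN1r twistP rmorphN1 mulN1r addrC. Qed.

Lemma twist_shift t F c y : A t (F \Po ('X + c%:P)) y = A t F (y + c).
Proof.
elim: t y => [|t IHt] y /=.
  by rewrite !horner_comp !hornerE [y + e + c]addrAC.
by apply: eq_bigr => i _; rewrite IHt [_ + _ + c]addrAC.
Qed.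

(** Says that the kernel paired with F^(j+1) has mean [M]: if F^(j+2) = 0, then F^(j+1) is constant
    and the functional sees nothing of the kernel but its mean. *)
Definition twist_exact t j (M : R[i]) := forall (F : {poly R}) (y : R), F^`(j.+2) = 0 ->
  A t F y = M * (F^`(j).[y + e * b%:R ^+ t] - F^`(j).[y])%:C.

(** Stands for a sup distance of at most [D] between the kernel and its mean [M]; the increment of
    [H] plays the part of the L^1 norm of F^(j+1). *)
Definition twist_approx t j (M : R[i]) (D : R) := forall (F H : {poly R}) (y : R),
  (forall x : R, y <= x <= y + e * b%:R ^+ t -> `|F^`(j.+1).[x]| <= H^`().[x]) ->
  `|A t F y - M * (F^`(j).[y + e * b%:R ^+ t] - F^`(j).[y])%:C|
    <= (D * (H.[y + e * b%:R ^+ t] - H.[y]))%:C.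

(** Stands for a sup bound [D] on the kernel itself. *)
Definition twist_bound t j (D : R) := forall (F H : {poly R}) (y : R),
  (forall x : R, y <= x <= y + e * b%:R ^+ t -> `|F^`(j.+1).[x]| <= H^`().[x]) ->
  `|A t F y| <= (D * (H.[y + e * b%:R ^+ t] - H.[y]))%:C.

Lemma twist_exact0 : twist_exact 0 0 1.
Proof. by move=> F y _ /=; rewrite mul1r expr0 mulr1. Qed.

Lemma twist_approx0 : twist_approx 0 0 1 0.
Proof.
by move=> F H y _ /=; rewrite !mul1r expr0 mulr1 subrr normr0 mul0r.
Qed.

Let blockE t (y : R) (i : 'I_b) :
  y + i%:R * (e * b%:R ^+ t) + e * b%:R ^+ t = y + i.+1%:R * (e * b%:R ^+ t).
Proof. by rewrite -natr1; ring. Qed.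

Let blocksE t (y : R) :
  y + e * b%:R ^+ t.+1 = y + b%:R * (e * b%:R ^+ t).
Proof. by rewrite exprS; ring. Qed.

Let block_sub t (y x : R) (i : 'I_b) :
  y + i%:R * (e * b%:R ^+ t) <= x <= y + i.+1%:R * (e * b%:R ^+ t) ->
  y <= x <= y + e * b%:R ^+ t.+1.
Proof.
have p0 : 0 <= e * b%:R ^+ t by rewrite mulr_ge0 ?exprn_ge0.
have h1 : 0 <= i%:R * (e * b%:R ^+ t) by rewrite mulr_ge0.
have h2 : i.+1%:R * (e * b%:R ^+ t) <= b%:R * (e * b%:R ^+ t).
  by rewrite ler_wpM2r// ler_nat.
by rewrite blocksE => /andP[yx xy]; apply/andP; split; lra.
Qed.

Lemma telescope_blocks (V : zmodType) (f : R -> V) (y p : R) :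
  \sum_(i < b) (f (y + i.+1%:R * p) - f (y + i%:R * p)) = f (y + b%:R * p) - f y.
Proof.
rewrite -(big_mkord xpredT (fun i => f (y + i.+1%:R * p) - f (y + i%:R * p))).
by rewrite (@telescope_sumr _ 0%N b (fun i => f (y + i%:R * p)))// mul0r addr0.
Qed.

Lemma twist_exact_step1 t j M : z t = 1 -> twist_exact t j M -> twist_exact t.+1 j M.
Proof.
move=> zt ex F y Fj /=.
under eq_bigr do rewrite zt expr1n mul1r ex// blockE.
by rewrite -mulr_sumr -rmorph_sum /= (telescope_blocks (horner F^`(j))) -blocksE.
Qed.

Lemma twist_approx_step1 t j M D : z t = 1 ->
  twist_approx t j M D -> twist_approx t.+1 j M D.
Proof.
move=> zt ap F H y FH /=.
rewrite blocksE -(telescope_blocks (horner F^`(j))) -(telescope_blocks (horner H)).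
rewrite rmorph_sum mulr_sumr -sumrB mulr_sumr rmorph_sum.
apply: le_trans (ler_norm_sum _ _ _) _; apply: ler_sum => i _.
rewrite zt expr1n mul1r -blockE; apply: ap => x; rewrite blockE => xi.
by apply: FH; apply: block_sub xi.
Qed.

(** Serves the Walsh factors left over after the last integration by parts: being unimodular, they
    are lost in the triangle inequality at no cost. *)
Lemma twist_bound_step t j D : `|z t| = 1 -> twist_bound t j D -> twist_bound t.+1 j D.
Proof.
move=> zt ap F H y FH /=.
rewrite blocksE -(telescope_blocks (horner H)) mulr_sumr rmorph_sum.
apply: le_trans (ler_norm_sum _ _ _) _; apply: ler_sum => i _.
rewrite normrM normrX zt expr1n mul1r -blockE; apply: ap => x; rewrite blockE => xi.
by apply: FH; apply: block_sub xi.
Qed.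

Lemma twist_approx_bound t j M D D' : `|M| <= D'%:C ->
  twist_approx t j M D -> twist_bound t j (D' + D).
Proof.
move=> MD ap F H y FH.
have p0 : 0 <= e * b%:R ^+ t by rewrite mulr_ge0 ?exprn_ge0.
rewrite mulrDl rmorphD -(subrK (M * (F^`(j).[y + e * b%:R ^+ t] - F^`(j).[y])%:C) (A t F y)).
apply: le_trans (ler_normD _ _) _; rewrite addrC; apply: lerD; last exact: ap.
rewrite normrM rmorphM; apply: ler_pM => //; rewrite normC_real lecR.
by apply: horner_incr_le; rewrite ?lerDl// -derivnS.
Qed.

Let dconst (c : R) n : {poly R} := (c / n`!%:R) *: 'X^n.

Let derivn_dconst c n : (dconst c n)^`(n) = c%:P.
Proof.
rewrite /dconst derivnZ derivnXn subnn expr0 ffactnn -mulr_natr mul1r.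
rewrite -polyC_natr -mul_polyC -polyCM; congr (_%:P).
by rewrite mulfVK// pnatr_eq0 -lt0n fact_gt0.
Qed.

(** The source of the gained factor 1/2. F^(j+1) lies within half the increment of [H] of the
    average [c] of its two end values. Subtracting [q], whose derivative of order j+1 is [c], leaves
    the error unchanged by exactness, and the constant [d] then majorizes the derivative. *)
Let approx_half t j M D (F H : {poly R}) (y : R) : twist_exact t j M -> twist_approx t j M D ->
  (forall x : R, y <= x <= y + e * b%:R ^+ t -> `|F^`(j.+2).[x]| <= H^`().[x]) ->
  `|A t F y - M * (F^`(j).[y + e * b%:R ^+ t] - F^`(j).[y])%:C|
    <= (D * (e * b%:R ^+ t) / 2 * (H.[y + e * b%:R ^+ t] - H.[y]))%:C.
Proof.
move=> ex ap FH.
have p0 : 0 <= e * b%:R ^+ t by rewrite mulr_ge0 ?exprn_ge0.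
pose c := (F^`(j.+1).[y + e * b%:R ^+ t] + F^`(j.+1).[y]) / 2.
pose q := dconst c j.+1.
have q1 : q^`(j.+1) = c%:P by exact: derivn_dconst.
have := ex q y; rewrite derivnS q1 derivC => /(_ erefl) qE.
pose d := (H.[y + e * b%:R ^+ t] - H.[y]) / 2.
have Fq x : y <= x <= y + e * b%:R ^+ t ->
    `|(F - q)^`(j.+1).[x]| <= (d *: 'X)^`().[x].
  move=> /andP[yx xy].
  rewrite derivnB q1 !poly.derivE !hornerE /=.
  have : `|F^`(j.+1).[x] - F^`(j.+1).[y]| <= H.[x] - H.[y].
    by apply: horner_incr_le => // u /andP[? ?]; apply: FH; lra.
  have : `|F^`(j.+1).[y + e * b%:R ^+ t] - F^`(j.+1).[x]| <= H.[y + e * b%:R ^+ t] - H.[x].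
    by apply: horner_incr_le => // u /andP[? ?]; apply: FH; lra.
  rewrite !ler_norml /d /c => /andP[? ?] /andP[? ?]; apply/andP; split; lra.
have -> : D * (e * b%:R ^+ t) / 2 * (H.[y + e * b%:R ^+ t] - H.[y])
    = D * ((d *: 'X).[y + e * b%:R ^+ t] - (d *: 'X).[y]).
  by rewrite !hornerZ !hornerX /d; field.
apply: le_trans (ap _ _ _ Fq); rewrite twistB qE derivnB !hornerE.
by rewrite le_eqVlt; apply/orP; left; apply/eqP; congr `| _ |;
  rewrite !(rmorphB, rmorphD) /=; ring.
Qed.

(** Exactness at level [t] cannot be applied to [F] itself, but it applies to a translate of [F]
    minus [F], whose derivative of order j+2 vanishes. So the values on the blocks differ from the
    first one by explicit increments; the common part is killed by the vanishing sum of roots of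
    unity. *)
Lemma twist_exact_step t j M : z t ^+ b = 1 -> z t != 1 ->
  twist_exact t j M -> twist_exact t.+1 j.+1 (M * (e * b%:R ^+ t)%:C / (z t - 1)).
Proof.
move=> zb z1 ex F y Fj /=.
set p := e * b%:R ^+ t.
pose Q (i : nat) := F \Po ('X + (i%:R * p)%:P) - F.
have derivn_comp n i : (F \Po ('X + (i%:R * p)%:P))^`(n) = F^`(n) \Po ('X + (i%:R * p)%:P).
  elim: n => // n IHn; rewrite !derivnS IHn deriv_comp derivD derivX derivC addr0.
  by rewrite mulr1.
have Qj i : (Q i)^`(j.+2) = 0.
  rewrite /Q derivnB derivn_comp.
  (* F^(j+2) has zero derivative, hence in characteristic zero is constant and invariant under
     translation. *)
  have /size1_polyC -> : (size F^`(j.+2) <= 1)%N.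
    rewrite leqNgt; apply/negP => s1.
    have := congr1 (fun q : {poly R} => q`_(size F^`(j.+2)).-2) Fj.
    rewrite derivnS coef_deriv coef0 => /eqP; rewrite mulrn_eq0 /=.
    rewrite prednK -?subn1 ?subn_gt0// subn1 -/(lead_coef _) lead_coef_eq0 => /eqP Fj0.
    by move: s1; rewrite (Fj0 : F^`(j.+2) = 0) size_poly0.
  by rewrite comp_polyC subrr.
have AE i : A t F (y + i%:R * p) = A t F y
   + M * (F^`(j).[y + i.+1%:R * p] - F^`(j).[y + i%:R * p])%:C
   - M * (F^`(j).[y + p] - F^`(j).[y])%:C.
  have := ex (Q i) y (Qj i); rewrite twistB twist_shift => /eqP.
  rewrite subr_eq => /eqP ->.
  rewrite /Q derivnB derivn_comp !(hornerD, hornerN, horner_comp, hornerX, hornerC) -/p.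
  have -> : y + p + i%:R * p = y + i.+1%:R * p by rewrite -natr1; ring.
  by rewrite !(rmorphB, rmorphD) /=; ring.
under eq_bigr => i _.
  rewrite AE (_ : _ * _ = (A t F y - M * (F^`(j).[y + p] - F^`(j).[y])%:C) * z t ^+ i
     + M * (z t ^+ i * (F^`(j).[y + i.+1%:R * p] - F^`(j).[y + i%:R * p])%:C)); last by ring.
  over.
rewrite big_split /= -!mulr_sumr root_unity_sum0// mulr0 add0r.
rewrite abel_sum_quadratic// -?derivnD ?addn3//.
  by rewrite blocksE -derivnS; ring.
Qed.

(** The error splits in two. Replacing the functional on each block by its mean part costs D p / 2
    by [approx_half], with p the block length; summing the mean parts by Abel summation costs m s
    p. *)
Lemma twist_approx_step t j M D s m : z t ^+ b = 1 -> z t != 1 -> `|z t| = 1 ->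
  `|(z t - 1)^-1| <= s%:C -> `|M| <= m%:C ->
  twist_exact t j M -> twist_approx t j M D ->
  twist_approx t.+1 j.+1 (M * (e * b%:R ^+ t)%:C / (z t - 1))
    (m * s * (e * b%:R ^+ t) + D * (e * b%:R ^+ t) / 2).
Proof.
move=> zb z1 zn zs Mm ex ap F H y FH /=.
rewrite blocksE in FH *.
set p := e * b%:R ^+ t in FH *.
have p0 : 0 <= p by rewrite mulr_ge0 ?exprn_ge0.
have FH2 x : y <= x <= y + b%:R * p -> `|(F^`(j))^`(2).[x]| <= H^`().[x].
  by move=> /FH; rewrite !derivnS.
have := abel_sum_le p0 zn z1 zs FH2.
rewrite zb mul1r -rmorphB -derivnS.
set S := \sum_(i < b) _ => SE.
rewrite (_ : _ - _ = (\sum_(i < b) z t ^+ i * (A t F (y + i%:R * p)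
   - M * (F^`(j).[y + i.+1%:R * p] - F^`(j).[y + i%:R * p])%:C))
   + M * (S - p%:C / (z t - 1) * (F^`(j.+1).[y + b%:R * p] - F^`(j.+1).[y])%:C)); last first.
  rewrite mulrBr [M * S]mulr_sumr addrA -big_split /=; congr (_ - _); last by rewrite !mulrA.
  by apply: eq_bigr => i _; ring.
apply: le_trans (ler_normD _ _) _; rewrite mulrDl [leRHS]rmorphD [leLHS]addrC; apply: lerD.
  rewrite normrM (_ : m * s * p * _ = m * (s * p * (H.[y + b%:R * p] - H.[y]))); last by ring.
  by rewrite [leRHS]rmorphM; apply: ler_pM.
rewrite -(telescope_blocks (horner H)) mulr_sumr rmorph_sum.
apply: le_trans (ler_norm_sum _ _ _) _; apply: ler_sum => i _.
rewrite normrM normrX zn expr1n mul1r.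
have := @approx_half t j M D F H (y + i%:R * p) ex ap.
rewrite blockE -/p; apply=> x xi; apply: FH.
by move/block_sub: xi; rewrite blocksE.
Qed.

End Twist.

(** * The root of unity omega_b *)

Lemma omegaX (R : realType) b m :
  omega b ^+ m = (cos (m%:R * (2 * pi / b%:R)) +i* sin (m%:R * (2 * pi / b%:R)))%C :> R[i].
Proof.
rewrite /omega; set th := 2 * pi / b%:R.
elim: m => [|m IHm]; first by rewrite mul0r cos0 sin0 expr0.
rewrite exprS IHm -natr1 mulrDl mul1r cosD sinD.
by apply/eqP; rewrite eq_complex /=; apply/andP; split; apply/eqP; ring.
Qed.

Lemma omega_root (R : realType) b : (0 < b)%N -> omega b ^+ b = 1 :> R[i].
Proof.
move=> b0; rewrite omegaX (_ : b%:R * _ = pi *+ 2); last first.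
  by rewrite -mulr_natl; field; rewrite pnatr_eq0 -lt0n.
by rewrite cos2pi sin2pi.
Qed.

Lemma norm_omegaX (R : realType) b m : `|omega b ^+ m : R[i]| = 1.
Proof. by rewrite omegaX normc_def /= cos2Dsin2 sqrtr1. Qed.

Lemma sin_piV_gt0 (R : realType) b : (2 <= b)%N -> 0 < sin (pi / b%:R : R).
Proof.
move=> b2; apply: sin_gt0_pi; rewrite divr_gt0 ?pi_gt0 ?ltr0n//=; last by lia.
by rewrite gtr_pMr ?pi_gt0// invf_lt1 ?ltr0n ?ltr1n//; lia.
Qed.

(** Cosine decreases on [0, pi], and multiples beyond pi are reflected by m -> b - m. *)
Lemma cos_multiple_le (R : realType) b m : (0 < m < b)%N ->
  cos (m%:R * (2 * pi / b%:R)) <= cos (2 * pi / b%:R) :> R.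
Proof.
move=> /andP[m0 mb]; set th := 2 * pi / b%:R.
have b0 : b%:R != 0 :> R by rewrite pnatr_eq0; lia.
have th0 : 0 < th by rewrite divr_gt0 ?mulr_gt0 ?pi_gt0 ?ltr0n//; lia.
have bth : b%:R * th = 2 * pi by rewrite /th; field.
have le1 i : (0 < i)%N -> i%:R * th <= pi -> cos (i%:R * th) <= cos th.
  move=> i0 ipi.
  have thi : th <= i%:R * th by rewrite ler_peMl ?(ltW th0)// ler1n.
  rewrite leNgt ltr_cos ?in_itv /= ?ipi ?(ltW th0) ?(le_trans thi)//.
    by rewrite -leNgt.
  by rewrite (le_trans _ thi)// ltW.
have [mpi|mpi] := leP (m%:R * th) pi; first exact: le1.
have -> : m%:R * th = pi *+ 2 - (b - m)%:R * th.
  by rewrite natrB ?(ltnW mb)// mulrBl bth -[pi *+ 2]mulr_natl; ring.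
rewrite addrC cosD2pi cosN; apply: le1; first by lia.
by rewrite natrB ?(ltnW mb)// mulrBl bth; lra.
Qed.

(** Since |e^(ix) - 1|^2 = 2 - 2 cos x, the smallest distance occurs at m = 1, where this is 4
    sin(pi/b)^2. *)
Lemma norm_omegaX_sub1 (R : realType) b m : (0 < m < b)%N ->
  (2 * sin (pi / b%:R))%:C <= `|(omega b)^*%C ^+ m - 1 : R[i]|.
Proof.
move=> mb; have b2 : (2 <= b)%N by lia.
have s0 := @sin_piV_gt0 R _ b2.
rewrite -rmorphXn omegaX normc_def /= lecR.
set x := m%:R * _; set y := pi / b%:R in s0 *.
have cx : cos x <= cos (2 * y) by rewrite /y mulrA; exact: cos_multiple_le.
have c2 : cos (2 * y) = 1 - 2 * sin y ^+ 2.
  by rewrite mulr_natl mulr2n cosD -!expr2 cos2sin2; ring.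
rewrite -[leLHS](@ger0_norm _ (2 * sin y)) ?mulr_ge0 ?(ltW s0)// -sqrtr_sqr.
apply: ler_wsqrtr.
have := cos2Dsin2 x; have := sin2cos2 y; nra.
Qed.

(** * Induction over the digits of k *)

(** Scanning the positions k, k - 1, ... downwards makes the list grow at its end as the blocks get
    longer, in the order of [nzpos]. *)
Definition nzprefix (b k t : nat) : seq nat :=
  [seq a <- [seq (k - i)%N | i <- iota 0 t] | kdigit b k a.-1 != 0%N].

Lemma nzprefixS b k t : nzprefix b k t.+1 =
  if kdigit b k (k - t).-1 != 0%N then rcons (nzprefix b k t) (k - t)%N
  else nzprefix b k t.
Proof.
rewrite /nzprefix -addn1 iotaD map_cat filter_cat /= add0n.
by case: ifP; rewrite ?cats1 ?cats0.
Qed.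

Lemma nzprefix_nzpos b k : nzprefix b k k = nzpos b k.
Proof.
rewrite /nzprefix /nzpos.
suff -> : [seq (k - i)%N | i <- iota 0 k] = rev (iota 1 k) by [].
apply: (@eq_from_nth _ 0%N); first by rewrite size_rev size_map !size_iota.
move=> i; rewrite size_map size_iota => ik.
rewrite (nth_map 0%N) ?size_iota// nth_rev ?size_iota// !nth_iota//; first lia.
by rewrite ltn_subrL; lia.
Qed.

(* osc_u in the header: bounds the sup distance of W_u to its mean, in units
   of b^(-mu_u(k)) / (2 sin(pi/b))^u. *)
Definition osc (R : realType) (b j : nat) : R :=
  iter j (fun d => 1 + sin (pi / b%:R) * d) 0.

(* Blocks of level t have length b^(-(k-t)), so z_t belongs to the digit of x in
   position k - t; position k is fine enough since the non-zero digits of k have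
   positions at most k. *)
Definition wphase (R : realType) (b k t : nat) : R[i] :=
  (omega b)^*%C ^+ kdigit b k (k - t).-1.

Section DigitInduction.
Variables (R : realType) (b k : nat).
Hypothesis b_ge2 : (2 <= b)%N.
Let s : R := (2 * sin (pi / b%:R))^-1.
Let e : R := b%:R ^- k.
(** On the first u entries of [nzpos b k] this is the unit b^(-mu_u(k)) / (2 sin(pi/b))^u. *)
Let gain (l : seq nat) : R := s ^+ size l * b%:R ^- (\sum_(a <- l) a).
Local Notation z := (wphase R b k).

Let b0 : 0 < b%:R :> R. Proof. by rewrite ltr0n; lia. Qed.
Let s0 : 0 < s. Proof. by rewrite invr_gt0 mulr_gt0// sin_piV_gt0. Qed.
Let e0 : 0 <= e. Proof. by rewrite invr_ge0 exprn_ge0// ltW. Qed.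

Let block_length t : (t <= k)%N -> e * b%:R ^+ t = b%:R ^- (k - t).
Proof.
move=> tk; have bN0 : b%:R != 0 :> R by rewrite gt_eqF.
rewrite /e -[in LHS](subnK tk) exprD.
by field; rewrite !expf_neq0.
Qed.

Let wphase_norm t : `|z t| = 1.
Proof. by rewrite /wphase -rmorphXn norm_conjC norm_omegaX. Qed.

Let wphase_root t : z t ^+ b = 1.
Proof.
rewrite /wphase -rmorphXn -rmorphXn exprAC omega_root ?expr1n ?rmorph1//.
by lia.
Qed.

Let kdigit_bound j : (kdigit b k j < b)%N.
Proof. by rewrite ltn_pmod//; lia. Qed.

Let wphase_sub1 t : kdigit b k (k - t).-1 != 0%N -> s^-1%:C <= `|z t - 1|.
Proof.
by move=> nz; rewrite invrK; apply: norm_omegaX_sub1; rewrite lt0n nz kdigit_bound.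
Qed.

Let wphase_neq1 t : kdigit b k (k - t).-1 != 0%N -> z t != 1.
Proof.
move=> /wphase_sub1 h; rewrite -subr_eq0 -normr_gt0; apply: lt_le_trans h.
by rewrite ltcR invr_gt0.
Qed.

Let wphase_inv t : kdigit b k (k - t).-1 != 0%N -> `|(z t - 1)^-1| <= s%:C.
Proof.
move=> nz; have := wphase_sub1 nz.
rewrite normfV (_ : s%:C = (s^-1%:C)^-1); last by rewrite -fmorphV invrK.
move=> h.
by rewrite lef_pV2 ?posrE ?normr_gt0 ?subr_eq0 ?wphase_neq1// ltcR invr_gt0.
Qed.

(** Here every non-zero digit scanned so far has been integrated by parts. The one in position k - t
    contributes [s], from 1 / (z_t - 1), and the block length b^(-(k - t)); a zero digit has phase 1
    and its blocks merely telescope. *)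
Lemma twist_digits t : (t <= k)%N ->
  let l := nzprefix b k t in
  exists M, [/\ `|M| <= (gain l)%:C, twist_exact b e z t (size l) M &
    twist_approx b e z t (size l) M (osc R b (size l) * gain l)].
Proof.
elim: t => [_|t IHt tk] /=.
  exists 1; rewrite /gain big_nil /= !expr0 invr1 mulr1 mul0r normr1; split => //.
    exact: twist_exact0.
  exact: twist_approx0.
have [M [Ml ex ap]] := IHt (ltnW tk).
rewrite nzprefixS; case: ifPn => [nz|/negPn/eqP nz]; last first.
  have zt : z t = 1 by rewrite /wphase nz.
  by exists M; split=> //; [exact: twist_exact_step1|exact: twist_approx_step1].
set l := nzprefix b k t in Ml ex ap *.
have p0 : 0 <= e * b%:R ^+ t by rewrite mulr_ge0 ?exprn_ge0.
have gE : gain (rcons l (k - t)%N) = gain l * s * (e * b%:R ^+ t).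
  rewrite block_length ?(ltnW tk)// /gain size_rcons -cats1 big_cat big_seq1 /=.
  rewrite exprD exprS invfM; ring.
have wt := wphase_inv nz.
exists (M * (e * b%:R ^+ t)%:C / (z t - 1)); rewrite size_rcons; split.
- rewrite gE (_ : (gain l * s * _)%:C = (gain l)%:C * s%:C * (e * b%:R ^+ t)%:C); last by rewrite !rmorphM.
  rewrite !normrM normC_real (ger0_norm p0) mulrAC.
  apply: ler_pM; [exact: mulr_ge0 | by rewrite ler0c | | exact: lexx].
  exact: ler_pM.
- exact: twist_exact_step (wphase_root t) (wphase_neq1 nz) ex.
- have := twist_approx_step e0 (wphase_root t) (wphase_neq1 nz) (wphase_norm t) wt Ml ex ap.
  (* The identity sin(pi/b) = s^-1 / 2 converts the halved old error into the recursion of [osc],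
     relative to a gain that has acquired a factor [s]. *)
  rewrite gE /osc iterS -/(osc R b (size l)) (_ : sin _ = s^-1 / 2).
    rewrite (_ : _ + _ = (1 + s^-1 / 2 * osc R b (size l)) * (gain l * s * (e * b%:R ^+ t)))//.
    by field; rewrite gt_eqF.
  by rewrite /s invrK; field.
Qed.

(** Up to the level that processes the u-th non-zero digit, the mean and the oscillation add up to a
    kernel bound; beyond it the order of differentiation stays at [u] and only [twist_bound_step] is
    used. *)
Lemma twist_digits_bound t u : (t <= k)%N -> (u <= size (nzprefix b k t))%N ->
  twist_bound b e z t u ((1 + osc R b u) * gain (take u (nzprefix b k t))).
Proof.
have full t' : (t' <= k)%N -> let l := nzprefix b k t' in
    twist_bound b e z t' (size l) ((1 + osc R b (size l)) * gain l).
  move=> tk l; have [M [Ml _ ap]] := twist_digits tk.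
  by rewrite mulrDl mul1r; exact: twist_approx_bound Ml ap.
elim: t => [|t IHt] tk.
  rewrite leqn0 => /eqP ->; rewrite take0; exact: full 0%N tk.
rewrite leq_eqVlt => /orP[/eqP ->|]; first by rewrite take_size; exact: full.
rewrite nzprefixS => ul.
have ut : (u <= size (nzprefix b k t))%N.
  by case: ifP ul => _; rewrite ?size_rcons// => /ltnW.
have := twist_bound_step e0 (wphase_norm t) (IHt (ltnW tk) ut).
case: ifP => // _; congr twist_bound; congr (_ * gain _).
rewrite -cats1 take_cat; case: ltnP => // ul2.
have -> : u = size (nzprefix b k t) by apply/eqP; rewrite eqn_leq ut.
by rewrite subnn take0 cats0 take_size.
Qed.

End DigitInduction.

(** * Constants *)

Lemma sin_le_id (R : realType) (x : R) : 0 <= x -> sin x <= x.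
Proof.
move=> x0.
have [|z _] := @MVT_segment R sin cos 0 x x0.
  exact/continuous_subspaceT/continuous_sin.
by rewrite sin0 !subr0 => ->; rewrite ler_piMl// cos_le1.
Qed.

(** For b >= 5, sin x <= x and pi <= 4 give 8/b <= 1 + 3/b. For b = 2, 3 the bound sin <= 1
    suffices, while b = 4 needs sin(pi/4)^2 = 1/2. *)
Lemma sin_pi_div_le (R : realType) b : (2 <= b)%N ->
  2 * sin (pi / b%:R) <= 1 + 3 / b%:R :> R.
Proof.
move=> b2; have [b5|] := leqP 5 b.
  have b0 : 0 < b%:R :> R by rewrite ltr0n; lia.
  have sl : sin (pi / b%:R) <= pi / b%:R :> R by rewrite sin_le_id// divr_ge0 ?pi_ge0.
  have p4 : pi <= 4 :> R by have := @pihalf_lt2 R; lra.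
  have h : 8 / b%:R <= 1 + 3 / b%:R :> R.
    rewrite -lerBlDr -mulrBl ler_pdivrMr// mul1r.
    have : (5%:R : R) <= b%:R by rewrite ler_nat.
    lra.
  have h3 : pi / b%:R <= 4 / b%:R :> R by rewrite ler_pM2r ?invr_gt0.
  lra.
move=> b5; have : b \in [:: 2; 3; 4]%N by rewrite !inE; lia.
rewrite !inE => /or3P[]/eqP ->.
- have := @sin_le1 R (pi / 2); lra.
- have := @sin_le1 R (pi / 3); lra.
- have h : sin (pi / 4) ^+ 2 = 1 / 2 :> R.
    have := @tan_piquarter R; rewrite /tan => t1.
    have c0 : cos (pi / 4 : R) != 0.
      by apply/eqP => c0; move: t1; rewrite c0 invr0 mulr0 => /esym/eqP; rewrite oner_eq0.
    have sc : sin (pi / 4) = cos (pi / 4) :> R.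
      by rewrite -[LHS](divfK c0) t1 mul1r.
    have := cos2Dsin2 (pi / 4 : R); rewrite -sc; lra.
  nra.
Qed.

Lemma oscS (R : realType) b j : osc R b j.+1 = 1 + sin (pi / b%:R) * osc R b j.
Proof. by []. Qed.

Lemma osc_ge0 (R : realType) b j : (2 <= b)%N -> 0 <= osc R b j.
Proof.
move=> b2; elim: j => // j IHj; rewrite oscS.
by rewrite addr_ge0// mulr_ge0// ltW// sin_piV_gt0.
Qed.

(** By induction 1 + osc_(j+1) <= 3 q^j. As q >= sin(pi/b) and q^j >= 1, the induction step is
    tightest at q^j = 1, where it reads 2 sin(pi/b) <= 3 q - 2; the right side exceeds 1 + 3/b. *)
Lemma osc_le (R : realType) b u : (2 <= b)%N ->
  1 + osc R b u <=
  3 ^+ minn 1 u * (1 + b%:R^-1 + (b%:R * (b%:R + 1))^-1) ^+ maxn 0 (u - 1).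
Proof.
move=> b2; have b0 : 0 < b%:R :> R by rewrite ltr0n; lia.
have := sin_pi_div_le R b2; have := @sin_le1 R (pi / b%:R).
have := @sin_piV_gt0 R b b2.
set q := 1 + b%:R^-1 + _; set sg := sin _ => sg0 sg1 sgq.
have q1 : 1 <= q.
  by rewrite /q -addrA lerDl addr_ge0 ?invr_ge0 ?mulr_ge0 ?addr_ge0// ltW.
have {sgq}sgq : 2 * sg <= 3 * q - 2.
  have : 0 <= (b%:R * (b%:R + 1))^-1 :> R by rewrite invr_ge0 mulr_ge0 ?addr_ge0.
  by move: sgq; rewrite /q; lra.
have P j : 1 + osc R b j.+1 <= 3 * q ^+ j.
  elim: j => [|j IHj]; first by rewrite /osc /= mulr0 addr0 expr0; lra.
  rewrite oscS -/sg exprS.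
  have : 1 <= q ^+ j by rewrite exprn_ege1.
  move: (osc R b j.+1) (q ^+ j) IHj => d Q dQ Q1.
  have : sg * d <= sg * (3 * Q - 1) by rewrite ler_pM2l//; lra.
  have : 0 <= (q - sg) * (Q - 1) by rewrite mulr_ge0//; lra.
  lra.
case: u => [|u]; first by rewrite /osc minn0 !expr0 mulr1 addr0.
by rewrite (_ : minn 1 u.+1 = 1%N) ?expr1 ?max0n ?subn1; [exact: P|lia].
Qed.

(** * Twisted increments and Walsh functions on elementary intervals *)

Lemma kdigit_block b t i m s : (m < b ^ t)%N -> (i < b)%N -> (s <= t)%N ->
  kdigit b (i * b ^ t + m) s = if s == t then i else kdigit b m s.
Proof.
move=> mt ib st; have b0 : (0 < b)%N by lia.
have bs n : (0 < b ^ n)%N by rewrite expn_gt0 b0.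
case: eqP => [->|/eqP sNt].
  by rewrite /kdigit divnMDl// divn_small// addn0 modn_small.
have lt : (s < t)%N by rewrite ltn_neqAle sNt.
have -> : (i * b ^ t = i * b ^ (t - s.+1) * b * b ^ s)%N.
  by rewrite -[t in LHS](subnK lt) expnD expnS !mulnA.
by rewrite /kdigit divnMDl// modnMDl.
Qed.

(** Flattens the nested sums: m enumerates the elementary intervals and its digits are the nested
    indices. In this form the functional can be matched with the integral of a step function. *)
Lemma twistE (R : rcfType) b e (z : nat -> R[i]) t (F : {poly R}) y :
  twist b e z t F y = \sum_(m < b ^ t) (\prod_(s < t) z s ^+ kdigit b m s)
    * (F.[y + m.+1%:R * e] - F.[y + m%:R * e])%:C.
Proof.
elim: t y => [|t IHt] y /=.
  by rewrite expn0 big_ord1 big_ord0 !mul1r mul0r addr0.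
rewrite expnS.
rewrite -(big_mkord xpredT (fun m : nat => (\prod_(s < t.+1) z s ^+ kdigit b m s)
    * (F.[y + m.+1%:R * e] - F.[y + m%:R * e])%:C)).
rewrite big_nat_mul big_mkord; apply: eq_bigr => i _.
rewrite -{1}[(i * b ^ t)%N]add0n big_addn mulSn addnK big_mkord IHt mulr_sumr.
apply: eq_bigr => m _; rewrite mulrA; congr (_ * _).
  rewrite big_ord_recr /= mulrC addnC kdigit_block// eqxx; congr (_ * _).
  apply: eq_bigr => s _; rewrite kdigit_block//; last exact: ltnW.
  by rewrite ltn_eqF.
have E n : y + i%:R * (e * b%:R ^+ t) + n%:R * e = y + (n + i * b ^ t)%:R * e.
  by rewrite natrD natrM natrX; ring.
by rewrite !E.
Qed.

(** * Monomials *)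

Lemma truncn_divn (R : realType) (x : R) (B : nat) : (0 < B)%N -> 0 <= x ->
  Num.truncn x = (Num.truncn (B%:R * x) %/ B)%N.
Proof.
move=> B0 x0; have B0' : 0 < B%:R :> R by rewrite ltr0n.
apply: truncn_def; have /andP[h1 h2] := truncn_itv (mulr_ge0 (ltW B0') x0).
set m := Num.truncn _ in h1 h2 *.
rewrite -(ler_pM2l B0') -(ltr_pM2l B0') -!natrM; apply/andP; split.
  by apply: le_trans h1; rewrite ler_nat mulnC leq_divM.
by apply: lt_le_trans h2 _; rewrite ler_nat mulnC ltn_ceil.
Qed.

(** On this interval the digit of x in position k - s is the s-th digit of m. The product may run
    over all s because a zero digit of k has phase 1. *)
Lemma conj_wal_block (R : realType) b k m (x : R) : (2 <= b)%N ->
  m%:R * b%:R ^- k <= x < m.+1%:R * b%:R ^- k ->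
  (wal b k x)^*%C = \prod_(s < k) wphase R b k s ^+ kdigit b m s.
Proof.
move=> b2 /andP[mx xm]; have b0 : 0 < b%:R :> R by rewrite ltr0n; lia.
have bk0 : 0 < b%:R ^+ k :> R by rewrite exprn_gt0.
have x0 : 0 <= x by rewrite (le_trans _ mx)// mulr_ge0// invr_ge0 ltW.
have mE : Num.truncn (b%:R ^+ k * x) = m.
  by apply: truncn_def; rewrite mulrC -ler_pdivrMr// mx -ltr_pdivlMr.
have dE (i : 'I_k) : xdigit b x (k - i) = kdigit b m i.
  rewrite /xdigit /kdigit (@truncn_divn _ _ (b ^ i)) ?expn_gt0 ?mulr_ge0 ?exprn_ge0 ?(ltW b0)//; last by lia.
  by rewrite natrX mulrA -exprD subnKC ?mE// ltnW.
rewrite /wal -nzprefix_nzpos /nzprefix rmorphXn big_filter big_map -[k in iota 0 k]subn0.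
rewrite -/(index_iota 0 k) big_mkcond big_mkord /= expr_sum.
apply: eq_bigr => i _; rewrite /wphase -exprM.
case: eqP => [->|_] /=; first by rewrite mul0n expr0.
by rewrite dE.
Qed.

(** The derivatives of a monomial are non-negative on [0, 1], so F^(u) can itself serve as the
    majorizing primitive [H], and its increment over [0, 1] is r! / (r - u + 1)!. The value 0 for r
    < u is the orthogonality of low degrees. *)
Lemma twist_monomial_le (R : realType) b k u r : (2 <= b)%N ->
  (u <= size (nzpos b k))%N ->
  `|twist b (b%:R ^- k) (wphase R b k) k (r.+1%:R^-1 *: 'X^(r.+1)) 0|
  <= ((1 + osc R b u) * ((2 * sin (pi / b%:R))^-1 ^+ u * b%:R ^- mu b u k)
      * (if (u <= r)%N then r`!%:R / ((r - u + 1)`!)%:R else 0))%:C.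
Proof.
move=> b2; rewrite -nzprefix_nzpos => ul.
have b0 : b%:R != 0 :> R by rewrite pnatr_eq0; lia.
have := @twist_digits_bound R b k b2 k u (leqnn _) ul.
set F := _ *: _; set D := _ * _ => /(_ F (F^`(u)) 0).
have -> : 0 + b%:R ^- k * b%:R ^+ k = 1 :> R.
  by rewrite add0r mulVf// expf_neq0.
have DE : D = (1 + osc R b u) * ((2 * sin (pi / b%:R))^-1 ^+ u * b%:R ^- mu b u k).
  by rewrite /D size_take_min (minn_idPl ul) nzprefix_nzpos.
rewrite DE => H; apply: le_trans (H _) _ => [x /andP[x0 _]|].
  rewrite -derivnS ger0_norm// /F derivnZ derivnXn hornerZ hornerMn hornerXn.
  by rewrite mulr_ge0 ?invr_ge0// mulrn_wge0// exprn_ge0.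
rewrite lecR le_eqVlt; apply/orP; left; apply/eqP; congr (_ * _).
rewrite /F derivnZ derivnXn !hornerZ !hornerMn !hornerXn expr1n.
have [ur|ru] := leqP u r.
  rewrite expr0n subn_eq0 ltnNge ur /= mul0rn mulr0 subr0 addn1 -subSn//.
  have /(congr1 (fun n => n%:R : R)) := ffact_fact (leqW ur).
  rewrite factS !natrM => E.
  have fN0 n : n`!%:R != 0 :> R by rewrite pnatr_eq0 -lt0n fact_gt0.
  apply: (mulIf (fN0 (r.+1 - u)%N)); by rewrite divfK// -mulrA E mulKf.
(* For u = r + 1 the derivative is a non-zero constant (0 ^+ 0 is 1), so its increment vanishes; for
   larger u it is zero. *)
have [->|ur] := eqVneq u r.+1.
  by rewrite subnn expr0 subrr.
by rewrite ffact_small ?mulr0n ?subrr//; lia.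
Qed.

(** * Integrals against step functions and power series *)

Lemma integrable_horner_itv (R : realType) (P : {poly R}) (a b : R) :
  lebesgue_measure.-integrable `[a, b[ (EFin \o horner P).
Proof.
have /integrableS : (@lebesgue_measure R).-integrable `[a, b] (EFin \o horner P).
  apply: continuous_compact_integrable; first exact: segment_compact.
  by apply: continuous_subspaceT; exact: continuous_horner.
by apply=> //; apply: subset_itvl; rewrite bnd_simp.
Qed.

Lemma Rintegral_deriv_poly (R : realType) (P : {poly R}) (a b : R) : a < b ->
  \int[lebesgue_measure]_(x in `[a, b[) P^`().[x] = P.[b] - P.[a].
Proof.
move=> ab; rewrite Rintegral_itv_bndo_bndc; last exact: integrable_horner_itv.
rewrite /Rintegral (@continuous_FTC2 _ _ (horner P))//.
- by apply: continuous_subspaceT; exact: continuous_horner.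
- split.
  + by move=> x _; exact: derivable_horner.
  + exact/cvg_at_right_filter/continuous_horner.
  + exact/cvg_at_left_filter/continuous_horner.
- by move=> x _; rewrite -derivE.
Qed.

Section StepFunction.
Variables (R : realType) (g : R -> R) (h : nat -> R) (e : R) (N : nat).
Hypothesis e_gt0 : 0 < e.
Hypothesis g_step : forall m x, (m < N)%N -> m%:R * e <= x < m.+1%:R * e -> g x = h m.

Let split_last n : (`[0%R, n.+1%:R * e[ = `[0%R, n%:R * e[ `|` `[n%:R * e, n.+1%:R * e[)%classic.
Proof.
by apply: itv_bndbnd_setU; rewrite bnd_simp ?mulr_ge0 ?(ltW e_gt0)// ler_pM2r// ler_nat.
Qed.

Lemma measurable_step n : (n <= N)%N -> measurable_fun `[0, n%:R * e[ g.
Proof.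
elim: n => [_|n IHn nN].
  by rewrite mul0r set_itvco0; exact: measurable_fun_set0.
rewrite split_last; apply/measurable_funU; [exact: measurable_itv|exact: measurable_itv|].
split; first by apply: IHn; exact: ltnW.
apply: (eq_measurable_fun (cst (h n))) => // x; rewrite inE /= in_itv /= => xn.
by rewrite (g_step nN).
Qed.

Hypothesis g_le1 : forall x, `|g x| <= 1.

Lemma integrable_poly_step (P : {poly R}) :
  lebesgue_measure.-integrable `[0, N%:R * e[ (EFin \o (fun x => P.[x] * g x)).
Proof.
have B : [bounded g x | x in `[0, N%:R * e[%classic].
  by exists 1; split => // M M1 x _ /=; rewrite (le_trans (g_le1 x))// ltW.
exact: integrableMl _ (integrable_horner_itv P 0 (N%:R * e)) (measurable_step (leqnn N)) B.
Qed.

Lemma Rintegral_poly_step (P : {poly R}) :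
  \int[lebesgue_measure]_(x in `[0, N%:R * e[) (P^`().[x] * g x)
  = \sum_(m < N) h m * (P.[m.+1%:R * e] - P.[m%:R * e]).
Proof.
suff H n : (n <= N)%N -> \int[lebesgue_measure]_(x in `[0, n%:R * e[) (P^`().[x] * g x)
    = \sum_(m < n) h m * (P.[m.+1%:R * e] - P.[m%:R * e]) by exact: H.
elim: n => [_|n IHn nN]; first by rewrite mul0r set_itvco0 Rintegral_set0 big_ord0.
rewrite split_last Rintegral_setU//; last 2 first.
- rewrite -split_last; apply: integrableS (integrable_poly_step P^`()) => //.
  by apply: subset_itvl; rewrite bnd_simp ler_pM2r// ler_nat.
- apply/disj_setPS => x [] /=; rewrite !in_itv /=.
  by move=> /andP[_ xn] /andP[nx _]; move: (lt_le_trans xn nx); rewrite ltxx.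
rewrite IHn 1?ltnW// big_ord_recr /=; congr (_ + _).
rewrite -Rintegral_deriv_poly; last by rewrite ltr_pM2r// ltr_nat.
rewrite -RintegralZl//; last exact: integrable_horner_itv.
apply: eq_Rintegral => x; rewrite inE /= in_itv /= => xn.
by rewrite (g_step nN)// mulrC.
Qed.

End StepFunction.

(** A primitive of the partial sum of the power series, since [twist] acts on primitives. *)
Definition psum (R : realType) (c : nat -> R) n : {poly R} :=
  \sum_(r < n) c r *: (r.+1%:R^-1 *: 'X^(r.+1)).

Lemma psumS (R : realType) (c : nat -> R) n :
  psum c n.+1 = c n *: (n.+1%:R^-1 *: 'X^(n.+1)) + psum c n.
Proof. by rewrite /psum big_ord_recr addrC. Qed.

Lemma deriv_psum (R : realType) (c : nat -> R) n (x : R) :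
  (psum c n)^`().[x] = series (fun r => c r * x ^+ r) n.
Proof.
elim: n => [|n IHn].
  by rewrite /psum big_ord0 deriv0 horner0 seriesEnat /= big_geq.
rewrite psumS seriesSr derivD hornerD IHn addrC; congr (_ + _).
rewrite !derivZ derivXn !hornerZ hornerMn hornerXn -[x ^+ _ *+ _]mulr_natl.
by rewrite mulKf// pnatr_eq0.
Qed.

Section TermwiseIntegral.
Variables (R : realType) (c : nat -> R) (f g : R -> R).
Local Notation leb := (@lebesgue_measure R).
Local Notation D := (`[0%R, 1%R[%classic : set R).
Hypothesis f_series : forall x : R, 0 <= x < 1 -> series (fun r => c r * x ^+ r) @ \oo --> f x.
Hypothesis g_meas : measurable_fun D g.
Hypothesis g_le1 : forall x, `|g x| <= 1.
Hypothesis c_summable : (\sum_(0 <= r <oo) (`|c r| / r.+1%:R)%:E < +oo)%E.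

Let term r (x : R) : \bar R := (`|c r| * x ^+ r)%:E.

Let majorant (x : R) : \bar R := (\sum_(0 <= r <oo) term r x)%E.

Let term_ge0 r (x : R) : D x -> (0 <= term r x)%E.
Proof. by rewrite /= /term in_itv /= => /andP[x0 _]; rewrite lee_fin mulr_ge0// exprn_ge0. Qed.

Let term_meas r : measurable_fun D (term r).
Proof.
by apply/measurable_EFinP/measurable_funM.
Qed.

Let term_int r : (\int[leb]_(x in D) term r x = (`|c r| / r.+1%:R)%:E)%E.
Proof.
pose P := `|c r| *: (r.+1%:R^-1 *: 'X^(r.+1)) : {poly R}.
have PE x : P^`().[x] = `|c r| * x ^+ r.
  rewrite !derivZ derivXn !hornerZ hornerMn hornerXn -[x ^+ _ *+ _]mulr_natl.
  by rewrite mulKf// pnatr_eq0.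
have I : leb.-integrable D (term r).
  apply: eq_integrable (integrable_horner_itv P^`() 0 1) => //.
  by move=> x _; rewrite /= PE.
rewrite -(fineK (integrable_fin_num _ I))//; congr (_%:E).
transitivity (\int[leb]_(x in D) P^`().[x]).
  by congr fine; apply: eq_integral => x _; rewrite PE.
by rewrite Rintegral_deriv_poly// !hornerZ !hornerXn expr1n expr0n /= !mulr0 subr0 mulr1.
Qed.

(** Exchanging sum and integral of non-negative terms turns the integral of the majorant into the
    sum of |c_r| / (r + 1), finite by [c_summable]. *)
Let majorant_integrable : leb.-integrable D majorant.
Proof.
apply/integrableP; split.
  by apply: (@ge0_emeasurable_sum _ _ _ D term xpredT) => [r x Dx _|r _]; [exact: term_ge0|exact: term_meas].
have -> : (\int[leb]_(x in D) `|majorant x| = \int[leb]_(x in D) majorant x)%E.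
  apply: eq_integral => x; rewrite inE => Dx; rewrite gee0_abs//.
  by apply: nneseries_ge0 => r _ _; exact: term_ge0.
have -> : (\int[leb]_(x in D) majorant x
    = \sum_(0 <= r <oo) \int[leb]_(x in D) term r x)%E.
  by apply: integral_nneseries => // r x Dx; exact: term_ge0.
by rewrite (eq_eseriesr (fun r _ => term_int r)).
Qed.

Let partial n (x : R) : \bar R := ((psum c n)^`().[x] * g x)%:E.

Let partial_meas n : measurable_fun D (partial n).
Proof.
by apply/measurable_EFinP/measurable_funM => //; exact: measurable_poly.
Qed.

Let partial_cvg x : D x -> partial ^~ x @ \oo --> (f x * g x)%:E.
Proof.
rewrite /= in_itv /= => x01; apply: cvg_EFin; first exact: nearW.
apply: cvgM; last exact: cvg_cst.
under eq_fun do rewrite deriv_psum; exact: f_series.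
Qed.

Let partial_le x n : D x -> (`|partial n x| <= majorant x)%E.
Proof.
move=> Dx; have [x0 _] : 0 <= x /\ x < 1 by move: Dx; rewrite /= in_itv /= => /andP.
apply: le_trans (nneseries_lim_ge n (fun r _ _ => term_ge0 r Dx)).
rewrite sumEFin lee_fin normrM deriv_psum seriesEnat /=.
apply: le_trans (ler_piMr _ (g_le1 x)) _ => //.
apply: le_trans (ler_norm_sum _ _ _) _; apply: ler_sum => r _.
by rewrite normrM normrX (ger0_norm x0).
Qed.

Let limit_meas : measurable_fun D (fun x => (f x * g x)%:E : \bar R).
Proof. exact: emeasurable_fun_cvg partial_meas partial_cvg. Qed.

Let dominated : leb.-integrable D (EFin \o (fun x => f x * g x)) /\
  (fun n => \int[leb]_(x in D) partial n x)%E @ \oo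
    --> (\int[leb]_(x in D) (f x * g x)%:E)%E.
Proof.
have D1 := @dominated_convergence _ _ _ leb D (measurable_itv _) partial
  (fun x => (f x * g x)%:E) majorant partial_meas limit_meas.
case: D1 => //.
- by apply: aeW => x; exact: partial_cvg.
- by apply: aeW => x n; exact: partial_le.
Qed.

Lemma integrable_power_series : leb.-integrable D (EFin \o (fun x => f x * g x)).
Proof. by case: dominated. Qed.

Lemma cvg_Rintegral_power_series :
  (fun n => \int[leb]_(x in D) ((psum c n)^`().[x] * g x)) @ \oo -->
  \int[leb]_(x in D) (f x * g x).
Proof.
case: dominated => intf h; apply: fine_cvg; rewrite fineK//.
exact: integrable_fin_num intf.
Qed.

End TermwiseIntegral.

(** * Walsh coefficients *)

Lemma Re_sum_real (R : rcfType) n (u : nat -> R[i]) (d : nat -> R) :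
  complex.Re (\sum_(m < n) u m * (d m)%:C) = \sum_(m < n) complex.Re (u m) * d m.
Proof.
elim: n => [|n IHn]; first by rewrite !big_ord0.
rewrite !big_ord_recr /= -IHn.
by case: (\sum_(m < n) _) => x y; case: (u n) => x' y' /=; rewrite mulr0 subr0.
Qed.

Lemma Im_sum_real (R : rcfType) n (u : nat -> R[i]) (d : nat -> R) :
  complex.Im (\sum_(m < n) u m * (d m)%:C) = \sum_(m < n) complex.Im (u m) * d m.
Proof.
elim: n => [|n IHn]; first by rewrite !big_ord0.
rewrite !big_ord_recr /= -IHn.
by case: (\sum_(m < n) _) => x y; case: (u n) => x' y' /=; rewrite mulr0 add0r mulrC.
Qed.

Lemma conj_wal_norm (R : realType) b k (x : R) : `|(wal b k x)^*%C| = 1.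
Proof. by rewrite /wal norm_conjC norm_omegaX. Qed.

Lemma Re_norm1_le (R : rcfType) (z : R[i]) : `|z| = 1 -> `|complex.Re z| <= 1.
Proof.
move=> z1; rewrite -(ler_pXn2r (n := 2))// ?nnegrE// expr1n real_normK ?num_real//.
have := add_Re2_Im2 z; rewrite z1 expr1n => /complexI <-.
by rewrite lerDl sqr_ge0.
Qed.

Lemma Im_norm1_le (R : rcfType) (z : R[i]) : `|z| = 1 -> `|complex.Im z| <= 1.
Proof.
move=> z1; rewrite -(ler_pXn2r (n := 2))// ?nnegrE// expr1n real_normK ?num_real//.
have := add_Re2_Im2 z; rewrite z1 expr1n => /complexI <-.
by rewrite lerDr sqr_ge0.
Qed.

Section WalshCoefficient.
Variables (R : realType) (b k : nat).
Hypothesis b_ge2 : (2 <= b)%N.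
Let e : R := b%:R ^- k.
Local Notation A P := (twist b e (wphase R b k) k P 0).
Local Notation leb := (@lebesgue_measure R).
Let wc (x : R) : R[i] := (wal b k x)^*%C.
Let gam m : R[i] := \prod_(s < k) wphase R b k s ^+ kdigit b m s.

Let e0 : 0 < e.
Proof. by rewrite invr_gt0 exprn_gt0// ltr0n; lia. Qed.

Let Ne : (b ^ k)%:R * e = 1.
Proof. by rewrite natrX mulfV// expf_neq0// pnatr_eq0; lia. Qed.

Let wcE m (x : R) : m%:R * e <= x < m.+1%:R * e -> wc x = gam m.
Proof. exact: conj_wal_block. Qed.

Let stepRe m x : (m < b ^ k)%N -> m%:R * e <= x < m.+1%:R * e ->
  complex.Re (wc x) = complex.Re (gam m).
Proof. by move=> _ /wcE ->. Qed.

Let stepIm m x : (m < b ^ k)%N -> m%:R * e <= x < m.+1%:R * e ->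
  complex.Im (wc x) = complex.Im (gam m).
Proof. by move=> _ /wcE ->. Qed.

Let wcRe x : `|complex.Re (wc x)| <= 1.
Proof. exact/Re_norm1_le/conj_wal_norm. Qed.

Let wcIm x : `|complex.Im (wc x)| <= 1.
Proof. exact/Im_norm1_le/conj_wal_norm. Qed.

Let AE P : A P = \sum_(m < b ^ k) gam m * (P.[m.+1%:R * e] - P.[m%:R * e])%:C.
Proof. by rewrite twistE; apply: eq_bigr => m _; rewrite !add0r. Qed.

Let intRe P : \int[leb]_(x in `[0, 1[) (P^`().[x] * complex.Re (wc x)) = complex.Re (A P).
Proof.
by have := Rintegral_poly_step e0 stepRe wcRe P; rewrite Ne AE
  (Re_sum_real _ gam (fun m => P.[m.+1%:R * e] - P.[m%:R * e])).
Qed.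

Let intIm P : \int[leb]_(x in `[0, 1[) (P^`().[x] * complex.Im (wc x)) = complex.Im (A P).
Proof.
by have := Rintegral_poly_step e0 stepIm wcIm P; rewrite Ne AE
  (Im_sum_real _ gam (fun m => P.[m.+1%:R * e] - P.[m%:R * e])).
Qed.

Variables (f : R -> R) (c : nat -> R).
Hypothesis f_series : forall x : R, 0 <= x < 1 -> series (fun r => c r * x ^+ r) @ \oo --> f x.
Hypothesis c_summable : (\sum_(0 <= r <oo) (`|c r| / r.+1%:R)%:E < +oo)%E.

Let measRe : measurable_fun (`[0, 1[%classic : set R) (fun x => complex.Re (wc x)).
Proof. by rewrite -Ne; exact: measurable_step e0 stepRe _ (leqnn _). Qed.

Let measIm : measurable_fun (`[0, 1[%classic : set R) (fun x => complex.Im (wc x)).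
Proof. by rewrite -Ne; exact: measurable_step e0 stepIm _ (leqnn _). Qed.

Let cvgRe : (fun n => complex.Re (A (psum c n))) @ \oo --> complex.Re (walsh_coef b f k).
Proof.
have -> : complex.Re (walsh_coef b f k) = \int[leb]_(x in `[0, 1[) (f x * complex.Re (wc x)).
  rewrite Rintegral_itv_bndo_bndc; last exact: integrable_power_series f_series measRe wcRe c_summable.
  apply: eq_Rintegral => x _; rewrite /wc.
  rewrite -[(wal b k x)^*]/((wal b k x)^*%C).
  by case: (wal b k x)^*%C => u w /=; rewrite mul0r subr0.
under eq_fun do rewrite -intRe.
exact: cvg_Rintegral_power_series f_series measRe wcRe c_summable.
Qed.

Let cvgIm : (fun n => complex.Im (A (psum c n))) @ \oo --> complex.Im (walsh_coef b f k).
Proof.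
have -> : complex.Im (walsh_coef b f k) = \int[leb]_(x in `[0, 1[) (f x * complex.Im (wc x)).
  rewrite Rintegral_itv_bndo_bndc; last exact: integrable_power_series f_series measIm wcIm c_summable.
  apply: eq_Rintegral => x _; rewrite /wc.
  rewrite -[(wal b k x)^*]/((wal b k x)^*%C).
  by case: (wal b k x)^*%C => u w /=; rewrite mul0r addr0.
under eq_fun do rewrite -intIm.
exact: cvg_Rintegral_power_series f_series measIm wcIm c_summable.
Qed.

(** The functional at [psum c n] is the Walsh coefficient of the n-th partial sum, so a uniform
    bound survives the limit; it is carried over through the squared modulus, as convergence is
    known for real and imaginary parts separately. *)
Lemma walsh_coef_le (B : R) : (forall n, `|A (psum c n)| <= B%:C) ->
  ComplexField.Normc.normc (walsh_coef b f k) <= B.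
Proof.
move=> AB; have B0 : 0 <= B by rewrite -ler0c (le_trans _ (AB 0%N)).
have H : complex.Re (walsh_coef b f k) ^+ 2 + complex.Im (walsh_coef b f k) ^+ 2 <= B ^+ 2.
  have h : (fun n => complex.Re (A (psum c n)) ^+ 2 + complex.Im (A (psum c n)) ^+ 2) @ \oo
     --> complex.Re (walsh_coef b f k) ^+ 2 + complex.Im (walsh_coef b f k) ^+ 2.
    by apply: cvgD; rewrite expr2; under eq_fun do rewrite expr2; apply: cvgM.
  apply: (cvgr_to_le h); apply: nearW => n.
  by rewrite -lecR add_Re2_Im2 rmorphXn /= lerXn2r ?nnegrE// ler0c.
move: H; case: (walsh_coef b f k) => u w /= H.
by rewrite -[leRHS](ger0_norm B0) -sqrtr_sqr ler_wsqrtr.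
Qed.

End WalshCoefficient.

(** * Summation over the monomials and conclusion *)

Lemma twist_psum_le (R : realType) b k u (c : nat -> R) n : (2 <= b)%N ->
  (u <= size (nzpos b k))%N ->
  `|twist b (b%:R ^- k) (wphase R b k) k (psum c n) 0|
  <= ((1 + osc R b u) * ((2 * sin (pi / b%:R))^-1 ^+ u * b%:R ^- mu b u k)
      * \sum_(size (nzpos b k) <= r < n) r`!%:R * `|c r| / (r - u + 1)`!%:R)%:C.
Proof.
move=> b2 uv; elim: n => [|n IHn].
  by rewrite /psum big_ord0 -(subrr 0) twistB subrr normr0 big_geq// mulr0.
rewrite psumS twistP; apply: le_trans (ler_normD _ _) _.
rewrite normrM normC_real; have [vn|nv] := leqP (size (nzpos b k)) n.
  rewrite big_nat_recr//= [X in (_ * X)%:C]addrC mulrDr [leRHS]rmorphD lerD//.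
  have := twist_monomial_le R n b2 uv; rewrite (leq_trans uv vn).
  move=> /(ler_wpM2l (_ : 0 <= `|c n|%:C)); rewrite ler0c => /(_ (normr_ge0 _)).
  by move/le_trans; apply; rewrite -rmorphM lecR le_eqVlt; apply/orP; left; apply/eqP; ring.
(* The monomial bound is used at v, the number of non-zero digits, instead of [u]: this removes
   every degree below v, including those between u and v. *)
have := twist_monomial_le R n b2 (leqnn (size (nzpos b k))); rewrite leqNgt nv /= mulr0 normr_le0 => /eqP ->.
by rewrite normr0 mulr0 add0r (le_trans IHn)// !big_geq// ltnW.
Qed.

Theorem theorem1 (R : realType) (b : nat) (hb : (2 <= b)%N)
  (f : R -> R) (c : nat -> R)
  (hf : forall x : R, 0 <= x <= 1 -> series (fun r => c r * x ^+ r) @ \oo --> f x)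
  (k v : nat) (hk : (0 < k)%N) (hv : size (nzpos b k) = v) :
  ((ComplexField.Normc.normc (walsh_coef b f k))%:E <=
   \big[mine/+oo]_(0 <= u < v.+1)
     ((b%:R ^- mu b u k * (3 ^+ minn 1 u / (2 * sin (pi / b%:R)) ^+ u)
       * (1 + b%:R^-1 + (b%:R * (b%:R + 1))^-1) ^+ maxn 0 (u - 1))%R%:E
      * \sum_(v <= r <oo) ((r`!)%:R * `|c r| / ((r - u + 1)`!)%:R)%R%:E))%E.
Proof.
rewrite big_seq_cond; apply: le_bigmin; first exact: leey.
move=> u; rewrite andbT mem_index_iota ltnS => /andP[_ uv].
set pref := b%:R ^- _ * _ * _.
have b0 : 0 < b%:R :> R by rewrite ltr0n; lia.
have s0 := @sin_piV_gt0 R b hb.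
have pref0 : 0 < pref.
  have q0 : 0 < 1 + b%:R^-1 + (b%:R * (b%:R + 1))^-1 :> R.
    by rewrite !addr_gt0 ?invr_gt0// mulr_gt0// addr_gt0.
  by rewrite /pref !mulr_gt0 ?invr_gt0 ?exprn_gt0// mulr_gt0.
(* In the sum u <= v <= r, so the subtraction r - u is not truncated there. *)
set t := fun r => r`!%:R * `|c r| / (r - u + 1)`!%:R.
have t0 r : 0 <= t r by rewrite /t divr_ge0// mulr_ge0.
have T0 : (0 <= \sum_(v <= r <oo) (t r)%:E)%E by apply: nneseries_ge0 => r _ _; rewrite lee_fin.
have [Tfin|] := ltP (\sum_(v <= r <oo) (t r)%:E)%E +oo%E; last first.
  by rewrite leye_eq => /eqP ->; rewrite gt0_muley ?lte_fin// leey.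
have TE : (\sum_(v <= r <oo) (t r)%:E)%E \is a fin_num by rewrite ge0_fin_numE.
rewrite -(fineK TE) -EFinM lee_fin.
apply: (walsh_coef_le hb (c := c)).
- by move=> x /andP[x0 x1]; apply: hf; rewrite x0 ltW.
- have c0 r : (0 <= r)%N -> (0 <= (`|c r| / r.+1%:R)%:E)%E by move=> _; rewrite lee_fin divr_ge0.
  (* The first v terms form a finite sum. The others satisfy |c_r| / (r + 1) <= t r, which amounts
     to (r - u + 1)! <= (r + 1)!. *)
  rewrite (nneseries_split 0 v c0) add0n.
  rewrite lte_add_pinfty//.
    by rewrite sumEFin ltry.
  apply: le_lt_trans Tfin; apply: lee_nneseries => [r _ _|r _]; first by rewrite lee_fin divr_ge0.
  have fN0 m : 0 < m`!%:R :> R by rewrite ltr0n fact_gt0.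
  rewrite lee_fin /t ler_pdivlMr// mulrAC ler_pdivrMr ?ltr0n// mulrAC.
  rewrite mulrC ler_wpM2r// -natrM ler_nat mulnC -factS.
  by rewrite leq_fact// addn1 ltnS leq_subr.
- move=> n; apply: le_trans (twist_psum_le c n hb (_ : (u <= _)%N)) _; first by rewrite hv.
  rewrite lecR hv; apply: ler_pM.
  + rewrite mulr_ge0 ?addr_ge0 ?osc_ge0//.
    by rewrite mulr_ge0 ?exprn_ge0 ?invr_ge0 ?exprn_ge0 ?mulr_ge0 ?(ltW s0)// ltW.
  + exact: sumr_ge0.
  + have -> : pref = 3 ^+ minn 1 u * (1 + b%:R^-1 + (b%:R * (b%:R + 1))^-1) ^+ maxn 0 (u - 1)
        * ((2 * sin (pi / b%:R))^-1 ^+ u * b%:R ^- mu b u k) by rewrite /pref exprVn; ring.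
    rewrite ler_wpM2r ?osc_le//.
    by rewrite mulr_ge0 ?invr_ge0 ?exprn_ge0 ?invr_ge0 ?mulr_ge0 ?(ltW s0)// ltW.
  + rewrite -lee_fin (fineK TE) -sumEFin; exact: nneseries_lim_ge.
Qed.
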